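(* Any real tree with countably many vertices is an asymptotic subcone of the hyperbolic plane.
   Context: Geodesic segments and geodesic spaces: for points $x_0,x_1$ of a metric space $X$ with $a=d_X(x_0,x_1)$, a geodesic segment connecting $x_0$ and $x_1$ is an isometric (distance-preserving) map $g:[0,a]\to X$ with $g(0)=x_0$, $g(a)=x_1$; its image is also called a geodesic segment. $X$ is geodesic if every two of its points are connected by a (not necessarily unique) geodesic segment. Real tree: a metric space $X$ such that (1) for every two distinct points there is a unique geodesic segment joining them, and (2) if two geodesic segments $[a,b]$ and $[b,c]$ have exactly the one point $b$ (a common endpoint) in common, then their union is also a geodesic segment. Real tree with countably many vertices: a real tree $T$ for which there is a countable (finite or infinite) set $V\subset T$, the set of vertices, such that $T$ is the union of the geodesic segments joining pairs of points of $V$. Isometric embedding at infinity: let $(X,d_X)$ be a metric space of infinite diameter. A metric space $(T,d_T)$ can be isometrically embedded at infinity into $X$ if there are a fixed sequence of positive numbers $\varepsilon_i\to 0$ and, for every $t\in T$, an infinite sequence $\{x_t^i\}_{i=1,2,\dots}$ of points of $X$ such that $\lim_{i\to\infty}\varepsilon_i\, d_X(x_{t_1}^i,x_{t_2}^i)=d_T(t_1,t_2)$ for every $t_1,t_2\in T$. Asymptotic subcone: a metric space $X_0$ is an asymptotic subcone of $X$ if $X_0$ is geodesic and every finite subset of $X_0$ (with the induced metric) can be isometrically embedded at infinity into $X$ (the sequence $\varepsilon_i$ may depend on the finite subset). Hyperbolic plane: the unit disc $\{x\in\mathbb{C}: |x|<1\}$ with the distance $d_X(x_1,x_2)=\ln\frac{|1-x_1\overline{x_2}|+|x_1-x_2|}{|1-x_1\overline{x_2}|-|x_1-x_2|}$.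 *)

(* Defs.v *)
From HB Require Import structures.
From mathcomp Require Import all_boot all_order all_algebra.
From mathcomp Require Import all_classical all_reals all_analysis.
From mathcomp Require Import complex ring lra.

Set Implicit Arguments.
Unset Strict Implicit.
Unset Printing Implicit Defensive.

Import Order.TTheory GRing.Theory Num.Theory.
Import numFieldNormedType.Exports.
Import Normc.

Local Open Scope classical_set_scope.
Local Open Scope ring_scope.

Section Geodesics.
Context {R : realType}.

(* The geodesic is a total map on R of which only the restriction to
   [0, mdist x y] is constrained or used. *)
Definition geodesic_map (X : metricType R) (x y : X) (g : R -> X) : Prop :=
  [/\ {in `[0, mdist x y] &, forall s t, mdist (g s) (g t) = `|s - t|},
      g 0 = x & g (mdist x y) = y].

Definition geodesic_segment (X : metricType R) (x y : X) (S : set X) : Prop :=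
  exists2 g : R -> X, geodesic_map x y g & S = g @` `[0, mdist x y].

Definition geodesic_space (X : metricType R) : Prop :=
  forall x y : X, exists S, geodesic_segment x y S.

(* Uniqueness is that of the image; two geodesic maps with the same
   endpoints and the same image agree on [0, mdist x y]. *)
Definition real_tree (X : metricType R) : Prop :=
  (forall x y : X, x != y -> exists! S, geodesic_segment x y S) /\
  (forall (a b c : X) (S1 S2 : set X),
     geodesic_segment a b S1 -> geodesic_segment b c S2 ->
     S1 `&` S2 = [set b] ->
     exists x y, geodesic_segment x y (S1 `|` S2)).

Definition real_tree_countably_many_vertices (X : metricType R) : Prop :=
  real_tree X /\
  exists2 V : set X, countable V &
    [set: X] = [set t | exists v w S,
                  [/\ V v, V w, geodesic_segment v w S & S t]].

End Geodesics.

Section InducedMetric.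
Context {R : realType} {X : metricType R} (A : set X).

Definition subspace_metric : Type := set_type A.

HB.instance Definition _ := Choice.copy subspace_metric (set_type A).

Definition subspace_dist (x y : subspace_metric) : R :=
  mdist (\val (x : set_type A)) (\val (y : set_type A)).

Lemma subspace_distxx x : subspace_dist x x = 0.
Proof. exact: mdistxx. Qed.

Lemma subspace_dist_eq0 x y : subspace_dist x y = 0 -> x = y.
Proof. by move=> /mdist_positivity /val_inj. Qed.

Lemma subspace_dist_sym x y : subspace_dist x y = subspace_dist y x.
Proof. exact: metric_sym. Qed.

Lemma subspace_dist_triangle y x z :
  subspace_dist x z <= subspace_dist x y + subspace_dist y z.
Proof. exact: metric_triangle. Qed.

HB.instance Definition _ := @isMetric.Build R subspace_metric subspace_dist
  subspace_distxx subspace_dist_eq0 subspace_dist_sym subspace_dist_triangle.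

End InducedMetric.

Section Asymptotic.
Context {R : realType}.

Definition diameter (X : metricType R) : \bar R :=
  ereal_sup [set (mdist p.1 p.2)%:E | p in [set: X * X]].

(* The notion presupposes that X has infinite diameter; this is recorded as
   a conjunct. *)
Definition isometrically_embeds_at_infinity (T X : metricType R) : Prop :=
  diameter X = +oo%E /\
  exists eps : nat -> R,
    [/\ forall i, 0 < eps i,
        eps @ \oo --> (0 : R) &
        exists x : T -> nat -> X, forall t1 t2 : T,
          (fun i => eps i * mdist (x t1 i) (x t2 i)) @ \oo --> mdist t1 t2].

Definition asymptotic_subcone (X0 X : metricType R) : Prop :=
  geodesic_space X0 /\
  forall F : set X0, finite_set F ->
    isometrically_embeds_at_infinity (subspace_metric F) X.

End Asymptotic.

Section HyperbolicPlane.
Context {R : realType}.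
Local Open Scope complex_scope.
Implicit Types x y z : R[i].

(* [normc] is the R-valued modulus on R[i]. *)
Definition hdist x y : R :=
  ln ((normc (1 - x * y^*) + normc (x - y)) /
      (normc (1 - x * y^*) - normc (x - y))).

Lemma normc_ge0 x : 0 <= normc x.
Proof. by case: x => a b; rewrite /normc sqrtr_ge0. Qed.

Lemma sqr_normcE (a b : R) : normc (a +i* b) ^+ 2 = a ^+ 2 + b ^+ 2.
Proof. by rewrite /normc sqr_sqrtr// addr_ge0 ?sqr_ge0. Qed.

Lemma normc_conj x : normc x^* = normc x.
Proof. by case: x => a b; rewrite /normc /= sqrrN. Qed.

Lemma normc_opp x : normc (- x) = normc x.
Proof. by case: x => a b; rewrite /normc /= !sqrrN. Qed.

Lemma hdist_identity x y :
  normc (1 - x * y^*) ^+ 2 - normc (x - y) ^+ 2 =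
  (1 - normc x ^+ 2) * (1 - normc y ^+ 2).
Proof.
case: x => a b; case: y => c d.
by rewrite !sqr_normcE; ring.
Qed.

Lemma one_sub_sqr_normc_gt0 x : normc x < 1 -> 0 < 1 - normc x ^+ 2.
Proof. by move=> x1; have x0 := normc_ge0 x; nra. Qed.

Lemma hdist_denom_gt0 x y : normc x < 1 -> normc y < 1 ->
  0 < normc (1 - x * y^*) - normc (x - y).
Proof.
move=> /one_sub_sqr_normc_gt0 x1 /one_sub_sqr_normc_gt0 y1.
have := hdist_identity x y; have := mulr_gt0 x1 y1.
have := normc_ge0 (1 - x * y^*); have := normc_ge0 (x - y).
by move: (normc (1 - _)) (normc (x - y)) => A B B0 A0; nra.
Qed.

Lemma normc_sub_sym x y : normc (x - y) = normc (y - x).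
Proof. by rewrite -normc_opp opprB. Qed.

Lemma normc_one_sub_sym x y : normc (1 - x * y^*) = normc (1 - y * x^*).
Proof.
rewrite -normc_conj; congr normc; case: x => a b; case: y => c d.
by apply/eqP; rewrite eq_complex /=; apply/andP; split; apply/eqP; ring.
Qed.

Lemma hdist_sym x y : hdist x y = hdist y x.
Proof. by rewrite /hdist normc_sub_sym normc_one_sub_sym. Qed.

Lemma hdistxx x : normc x < 1 -> hdist x x = 0.
Proof.
move=> x1; have := hdist_denom_gt0 x1 x1.
rewrite /hdist subrr normc0 addr0 subr0 => A0.
by rewrite divff ?gt_eqF// ln1.
Qed.

Lemma hdist_eq0 x y : normc x < 1 -> normc y < 1 -> hdist x y = 0 -> x = y.
Proof.
move=> x1 y1; have := hdist_denom_gt0 x1 y1; rewrite /hdist.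
have := normc_ge0 (1 - x * y^*); have := normc_ge0 (x - y).
move ABE : (normc (1 - _)) => A; move BE : (normc (x - y)) => B B0 A0 AB.
have q0 : 0 < (A + B) / (A - B) by rewrite divr_gt0//; lra.
rewrite -[RHS]ln1 => /ln_inj; rewrite !posrE => /(_ q0 ltr01) q1.
have {}q1 : A + B = A - B by rewrite -[RHS]mul1r -q1 divfK// gt_eqF.
have B00 : B = 0 by lra.
by apply/eqP; rewrite -subr_eq0; apply/eqP/eq0_normc; rewrite BE.
Qed.

Lemma hdist_Mobius_one_sub x y z :
  (1 - normc y ^+ 2) * normc (1 - x * z^*) <=
  normc (1 - x * y^*) * normc (1 - y * z^*) + normc (x - y) * normc (y - z).
Proof.
rewrite (normc_sub_sym y) -(normc_conj (z - y)) -!normcM.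
rewrite -[X in _ <= _ + X]normc_opp.
apply: le_trans (le_normcD _ _).
have -> : (1 - x * y^*) * (1 - y * z^*) - (x - y) * (z - y)^* =
   (1 - normc y ^+ 2)%:C * (1 - x * z^*).
  case: x y z => a b [c d] [e f]; rewrite sqr_normcE.
  by apply/eqP; rewrite eq_complex /=; apply/andP; split; apply/eqP; ring.
rewrite normcM ler_wpM2r ?normc_ge0//.
by rewrite /normc /= expr0n addr0 sqrtr_sqr ler_norm.
Qed.

Lemma hdist_Mobius_sub x y z :
  (1 - normc y ^+ 2) * normc (x - z) <=
  normc (x - y) * normc (1 - y * z^*) + normc (1 - x * y^*) * normc (y - z).
Proof.
rewrite (normc_one_sub_sym y) (normc_sub_sym y) -!normcM.
rewrite -[X in _ <= _ + X]normc_opp.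
apply: le_trans (le_normcD _ _).
have -> : (x - y) * (1 - z * y^*) - (1 - x * y^*) * (z - y) =
   (1 - normc y ^+ 2)%:C * (x - z).
  case: x y z => a b [c d] [e f]; rewrite sqr_normcE.
  by apply/eqP; rewrite eq_complex /=; apply/andP; split; apply/eqP; ring.
rewrite normcM ler_wpM2r ?normc_ge0//.
by rewrite /normc /= expr0n addr0 sqrtr_sqr ler_norm.
Qed.

Lemma hdistE x y : normc x < 1 -> normc y < 1 ->
  hdist x y = ln ((normc (1 - x * y^*) + normc (x - y)) ^+ 2 /
                  ((1 - normc x ^+ 2) * (1 - normc y ^+ 2))).
Proof.
move=> x1 y1; have AB := hdist_denom_gt0 x1 y1.
rewrite -hdist_identity /hdist; congr ln.
have := normc_ge0 (1 - x * y^*); have := normc_ge0 (x - y); move: AB.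
move: (normc (1 - _)) (normc (x - y)) => A B AB B0 A0.
rewrite subr_sqr expr2 invfM mulrACA [X in _ = X * _]mulrC.
by field; rewrite !gt_eqF//; lra.
Qed.

Lemma hdist_triangle y x z : normc x < 1 -> normc y < 1 -> normc z < 1 ->
  hdist x z <= hdist x y + hdist y z.
Proof.
move=> x1 y1 z1; rewrite !hdistE//.
have xy := hdist_denom_gt0 x1 y1; have yz := hdist_denom_gt0 y1 z1.
have xz := hdist_denom_gt0 x1 z1.
have := hdist_Mobius_one_sub x y z; have := hdist_Mobius_sub x y z.
move: (one_sub_sqr_normc_gt0 x1) (one_sub_sqr_normc_gt0 y1)
  (one_sub_sqr_normc_gt0 z1) xy yz xz.
have := normc_ge0 (x - y); have := normc_ge0 (y - z).
have := normc_ge0 (x - z).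
move: (1 - normc x ^+ 2) (1 - normc y ^+ 2) (1 - normc z ^+ 2) => p q r.
move: (normc (1 - x * y^*)) (normc (1 - y * z^*)) (normc (1 - x * z^*)).
move: (normc (x - y)) (normc (y - z)) (normc (x - z)) => B1 B2 B3 A1 A2 A3.
move=> B30 B20 B10 p0 q0 r0 AB1 AB2 AB3 hB hA.
have D1 : 0 < (A1 + B1) ^+ 2 / (p * q).
  by apply: divr_gt0; [apply: exprn_gt0; lra | exact: mulr_gt0].
have D2 : 0 < (A2 + B2) ^+ 2 / (q * r).
  by apply: divr_gt0; [apply: exprn_gt0; lra | exact: mulr_gt0].
have D3 : 0 < (A3 + B3) ^+ 2 / (p * r).
  by apply: divr_gt0; [apply: exprn_gt0; lra | exact: mulr_gt0].
rewrite -lnM ?posrE// ler_ln ?posrE//; last exact: mulr_gt0.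
have -> : (A1 + B1) ^+ 2 / (p * q) * ((A2 + B2) ^+ 2 / (q * r)) =
  ((A1 + B1) * (A2 + B2) / q) ^+ 2 / (p * r).
  by field; rewrite !gt_eqF.
rewrite ler_pM2r ?invr_gt0 ?mulr_gt0// ler_sqr ?nnegrE; last 2 first.
- lra.
- by rewrite divr_ge0 ?(ltW q0)// mulr_ge0//; lra.
by rewrite ler_pdivlMr//; lra.
Qed.

End HyperbolicPlane.

Definition hyperbolic_plane (R : realType) : Type := {x : R[i] | normc x < 1}.

Section HyperbolicPlaneMetric.
Context {R : realType}.

HB.instance Definition _ :=
  Choice.copy (hyperbolic_plane R) {x : R[i] | normc x < 1}.

Definition hyperbolic_dist (x y : hyperbolic_plane R) : R :=
  hdist (sval x) (sval y).

Lemma hyperbolic_distxx x : hyperbolic_dist x x = 0.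
Proof. by case: x => x x1; apply: hdistxx. Qed.

Lemma hyperbolic_dist_eq0 x y : hyperbolic_dist x y = 0 -> x = y.
Proof.
by case: x y => [x x1] [y y1] /hdist_eq0 => /(_ x1 y1) xy; apply: val_inj.
Qed.

Lemma hyperbolic_dist_sym x y : hyperbolic_dist x y = hyperbolic_dist y x.
Proof. exact: hdist_sym. Qed.

Lemma hyperbolic_dist_triangle y x z :
  hyperbolic_dist x z <= hyperbolic_dist x y + hyperbolic_dist y z.
Proof. by case: x y z => [x x1] [y y1] [z z1]; apply: hdist_triangle. Qed.

HB.instance Definition _ := @isMetric.Build R (hyperbolic_plane R)
  hyperbolic_dist hyperbolic_distxx hyperbolic_dist_eq0
  hyperbolic_dist_sym hyperbolic_dist_triangle.

End HyperbolicPlaneMetric.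

(* Main.v *)
Require Import Defs.
From mathcomp Require Import all_boot all_order all_algebra.
From mathcomp Require Import all_classical all_reals all_analysis.
From mathcomp Require Import complex ring lra.

(* A real tree satisfies the four point condition: with respect to any base
   point p, the Gromov product (a|b) is the length of the common initial part of
   the geodesics from p to a and from p to b, so (a|b) >= min((a|c), (c|b)).
   Any finite set F with this property embeds at infinity: e^{-n(a|b)} is
   an ultrametric on F, realized up to constants independent of n by real
   numbers th_a(n), and in the upper half plane the points th_a + i e^{-n d(p,a)} have
   mutual distances n d(a,b) + O(1). The Cayley transform moves them to the
   disc. *)

Set Implicit Arguments.
Unset Strict Implicit.
Unset Printing Implicit Defensive.

Import Order.TTheory GRing.Theory Num.Theory.
Import numFieldNormedType.Exports.
Import Normc.

Local Open Scope classical_set_scope.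
Local Open Scope ring_scope.

(** * Geodesics in real trees: concatenation and tripods *)

Section Geodesics.
Context {R : realType} {X : metricType R}.
Implicit Types (p x y a b c m : X) (g : R -> X) (s t : R).

Lemma geodesic_map_dist x y g s t : geodesic_map x y g ->
  0 <= s <= mdist x y -> 0 <= t <= mdist x y -> mdist (g s) (g t) = `|s - t|.
Proof. by case=> gd _ _ s0 t0; apply: gd; rewrite in_itv. Qed.

Lemma geodesic_map_inj x y g s t : geodesic_map x y g ->
  0 <= s <= mdist x y -> 0 <= t <= mdist x y -> g s = g t -> s = t.
Proof.
move=> gg s0 t0 gst; have := geodesic_map_dist gg s0 t0.
by rewrite gst mdistxx => /esym/normr0P; rewrite subr_eq0 => /eqP.
Qed.

Lemma geodesic_map_dist_start x y g s : geodesic_map x y g ->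
  0 <= s <= mdist x y -> mdist x (g s) = s.
Proof.
move=> gg /[dup] s0 /andP[s0' _]; have [_ g0 _] := gg.
rewrite -{1}g0 (geodesic_map_dist gg)// ?lexx ?mdist_ge0//.
by rewrite sub0r normrN ger0_norm.
Qed.

Lemma geodesic_map_dist_end x y g s : geodesic_map x y g ->
  0 <= s <= mdist x y -> mdist (g s) y = mdist x y - s.
Proof.
move=> gg /[dup] s0 /andP[_ s1]; have [_ _ g1] := gg.
rewrite -{1}g1 (geodesic_map_dist gg)// ?lexx ?mdist_ge0//.
by rewrite distrC ger0_norm// subr_ge0.
Qed.

Lemma geodesic_segment_sub x y g s t : geodesic_map x y g ->
  0 <= s -> s <= t -> t <= mdist x y ->
  geodesic_segment (g s) (g t) (g @` `[s, t]).
Proof.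
move=> gg s0 st td.
have dst : mdist (g s) (g t) = t - s.
  by rewrite (geodesic_map_dist gg) 1?distrC ?ger0_norm//; lra.
exists (fun r => g (s + r)).
  split; rewrite ?dst.
  - move=> u v; rewrite !in_itv/= => uI vI.
    by rewrite (geodesic_map_dist gg); [congr `|_|; ring|lra|lra].
  - by rewrite addr0.
  - by congr g; ring.
rewrite dst; apply/seteqP; split=> _ [u /= + <-]; rewrite in_itv/= => uI.
  by exists (u - s); [rewrite /= in_itv/=; lra|congr g; ring].
by exists (s + u) => //=; rewrite in_itv/=; lra.
Qed.

Lemma geodesic_segment_sym x y (S : set X) :
  geodesic_segment x y S -> geodesic_segment y x S.
Proof.
case=> g gg ->; have [_ g0 g1] := gg.
exists (fun r => g (mdist x y - r)); rewrite ?(metric_sym y x).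
  split; rewrite ?[mdist y x]metric_sym.
  - move=> u v; rewrite !in_itv/= => uI vI.
    rewrite (geodesic_map_dist gg); [|lra|lra].
    by rewrite -normrN; congr `|_|; ring.
  - by rewrite subr0.
  - by rewrite subrr.
apply/seteqP; split=> _ [u /= + <-]; rewrite in_itv/= => uI;
  (exists (mdist x y - u); [by rewrite /= in_itv/=; lra|congr g; ring]).
Qed.

Lemma geodesic_segment_l x y (S : set X) : geodesic_segment x y S -> S x.
Proof.
by case=> g [_ g0 _] ->; exists 0 => //=; rewrite in_itv/= lexx mdist_ge0.
Qed.

Lemma geodesic_segment_refl x : geodesic_segment x x [set x].
Proof.
exists (fun=> x); rewrite ?mdistxx.
  split=> // s t; rewrite mdistxx !in_itv/= => s0 t0.
  by rewrite (_ : s - t = 0) ?normr0//; lra.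
by apply/seteqP; split=> [_ ->|_ [_ _ <-]//]; exists 0 => //=;
  rewrite in_itv/= lexx.
Qed.

Hypothesis treeX : real_tree X.

Lemma real_tree_geodesic : geodesic_space X.
Proof.
move=> x y; have [<-|/treeX.1[S [xyS _]]] := eqVneq x y; last by exists S.
by exists [set x]; exact: geodesic_segment_refl.
Qed.

Lemma real_tree_segment_unique x y (S1 S2 : set X) : x != y ->
  geodesic_segment x y S1 -> geodesic_segment x y S2 -> S1 = S2.
Proof. by move=> /treeX.1[S [_ Su]] /Su <- /Su <-. Qed.

(* The endpoints of the segment [S1 `|` S2] given by the tree axiom are not
   specified; uniqueness of segments forces [b] to lie between [a] and [c]. *)
Lemma real_tree_concat a b c (S1 S2 : set X) :
  geodesic_segment a b S1 -> geodesic_segment b c S2 ->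
  S1 `&` S2 = [set b] -> mdist a c = mdist a b + mdist b c.
Proof.
move=> abS1 bcS2 S12.
have [->|ab] := eqVneq a b; first by rewrite mdistxx add0r.
have [->|bc] := eqVneq b c; first by rewrite mdistxx addr0.
have [x [y [g gg S12g]]] := treeX.2 _ _ _ _ _ abS1 bcS2 S12.
have memg z : (S1 `|` S2) z -> exists2 s, 0 <= s <= mdist x y & g s = z.
  by rewrite S12g => -[s /=]; rewrite in_itv/=; exists s.
have /memg[s sI gs] : (S1 `|` S2) a by left; exact: geodesic_segment_l abS1.
have /memg[t tI gt] : (S1 `|` S2) b by right; exact: geodesic_segment_l bcS2.
have /memg[u uI gu] : (S1 `|` S2) c.
  by right; exact: geodesic_segment_l (geodesic_segment_sym bcS2).
have absurd r : 0 <= r <= mdist x y -> S1 (g r) -> S2 (g r) -> r = t.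
  move=> rI r1 r2; apply: (geodesic_map_inj gg) => //.
  by rewrite gt; have : (S1 `&` S2) (g r) by []; rewrite S12.
have st : s <> t by move=> st; move: ab; rewrite -gs -gt st eqxx.
have tu : t <> u by move=> tu; move: bc; rewrite -gt -gu tu eqxx.
rewrite -gs -gt -gu !(geodesic_map_dist gg)//.
(* If [t] lies between [s] and [u], the distances add up. Otherwise uniqueness makes [S1] and [S2]
   images under [g] of intervals on the same side of [t]; these share more than their endpoint [t],
   against [absurd]. *)
have [stlt|tslt|//] := ltgtP s t; have [tult|utlt|//] := ltgtP t u.
- rewrite !ltr0_norm; lra.
- have S1E : S1 = g @` `[s, t].
    apply: (real_tree_segment_unique ab abS1).
    by rewrite -gs -gt; apply: (geodesic_segment_sub gg); lra.
  have S2E : S2 = g @` `[u, t].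
    apply: (real_tree_segment_unique bc bcS2); apply: geodesic_segment_sym.
    by rewrite -gu -gt; apply: (geodesic_segment_sub gg); lra.
  have : Num.max s u = t.
    apply: absurd; rewrite ?S1E ?S2E; first by case: (leP s u) => _.
      exists (Num.max s u) => //=; rewrite in_itv/=; case: (leP s u); lra.
    exists (Num.max s u) => //=; rewrite in_itv/=; case: (leP s u); lra.
  by case: (leP s u); lra.
- have S1E : S1 = g @` `[t, s].
    apply: (real_tree_segment_unique ab abS1); apply: geodesic_segment_sym.
    by rewrite -gs -gt; apply: (geodesic_segment_sub gg); lra.
  have S2E : S2 = g @` `[t, u].
    apply: (real_tree_segment_unique bc bcS2).
    by rewrite -gu -gt; apply: (geodesic_segment_sub gg); lra.
  have : Num.min s u = t.
    apply: absurd; rewrite ?S1E ?S2E; first by case: (leP s u) => _.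
      exists (Num.min s u) => //=; rewrite in_itv/=; case: (leP s u); lra.
    exists (Num.min s u) => //=; rewrite in_itv/=; case: (leP s u); lra.
  by case: (leP s u); lra.
- rewrite !gtr0_norm; lra.
Qed.

(** The number [u] is the largest parameter at which the two geodesics agree. Past it they share no
    point, since a common point has the same distance to [p] along both, hence equal parameters; so
    the two remaining arms meet only in [ga u] and [real_tree_concat] applies to them. *)
Lemma real_tree_tripod p a b ga gb :
  geodesic_map p a ga -> geodesic_map p b gb ->
  exists u, [/\ 0 <= u, u <= mdist p a, u <= mdist p b,
    mdist a b = mdist p a + mdist p b - 2 * u &
    forall s, 0 <= s <= u -> ga s = gb s].
Proof.
move=> gga ggb; have [_ ga0 ga1] := gga; have [_ gb0 gb1] := ggb.
pose E := [set s | [/\ 0 <= s, s <= mdist p a, s <= mdist p b & ga s = gb s]].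
have E0 : E 0 by split; rewrite ?mdist_ge0// ga0 gb0.
have supE : has_sup E.
  by split; [exists 0|exists (mdist p a) => s []].
have Eu := sup_upper_bound supE.
set u := sup E in Eu.
have u0 : 0 <= u by exact: Eu.
have ua : u <= mdist p a by apply: ge_sup; [exists 0|move=> s []].
have ub : u <= mdist p b by apply: ge_sup; [exists 0|move=> s []].
have gu : ga u = gb u.
  (* The supremum is attained: an [s] in [E] closer to [u] than half the gap between [ga u] and
     [gb u] would, via the point [ga s], make that gap smaller than itself. *)
  apply/eqP; rewrite -[_ == _]negbK -mdist_gt0; apply/negP => d0.
  have [s [s0 sa sb gs] us] := sup_adherent (divr_gt0 d0 (ltr0n _ 2)) supE.
  have su : s <= u by apply: Eu.
  have := metric_triangle (ga u) (ga s) (gb u).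
  rewrite {2}gs (geodesic_map_dist gga) ?(geodesic_map_dist ggb); try lra.
  by rewrite -/u in us; rewrite ger0_norm ?ler0_norm; lra.
have pu : mdist p (ga u) = u by rewrite (geodesic_map_dist_start gga)//; lra.
have agree s : 0 <= s <= u -> ga s = gb s.
  have [u00|un0] := eqVneq u 0.
    by rewrite u00 => /le_anti <-; rewrite ga0 gb0.
  move=> su; have pm : p != ga u.
    by rewrite -mdist_gt0 pu lt_neqAle eq_sym un0.
  have Sa : geodesic_segment p (ga u) (ga @` `[0, u]).
    by rewrite -{1}ga0; apply: (geodesic_segment_sub gga).
  have Sb : geodesic_segment p (ga u) (gb @` `[0, u]).
    by rewrite -{1}gb0 gu; apply: (geodesic_segment_sub ggb).
  have : (ga @` `[0, u]) (ga s) by exists s.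
  (* Both initial pieces join [p] to [ga u], so they are the same set; a parameter is then recovered
     as the distance to [p]. *)
  rewrite (real_tree_segment_unique pm Sa Sb) => -[t /=].
  rewrite in_itv/= => tu gts; rewrite -gts; congr gb.
  rewrite -(geodesic_map_dist_start gga (s := s)); last lra.
  by rewrite -gts (geodesic_map_dist_start ggb)//; lra.
exists u; split=> //.
have Sa : geodesic_segment a (ga u) (ga @` `[u, mdist p a]).
  apply: geodesic_segment_sym; rewrite -{1}ga1.
  by apply: (geodesic_segment_sub gga).
have Sb : geodesic_segment (ga u) b (gb @` `[u, mdist p b]).
  by rewrite gu -{1}gb1; apply: (geodesic_segment_sub ggb).
rewrite (real_tree_concat Sa Sb).
  by rewrite [mdist a (ga u)]metric_sym (geodesic_map_dist_end gga) ?gu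
    ?(geodesic_map_dist_end ggb); lra.
apply/seteqP; split=> [z [[s /= + sz] [t /= + tz]]|_ ->]; last first.
  split; [exists u|exists u] => //=; rewrite in_itv/=; lra.
rewrite !in_itv/= => sI tI.
have st : s = t.
  rewrite -(geodesic_map_dist_start gga (s := s)); last lra.
  by rewrite sz -tz (geodesic_map_dist_start ggb)//; lra.
have /Eu su : E s 
  by split; [lra|lra|lra|rewrite sz st tz].
by rewrite /= -sz; congr ga; apply/le_anti; lra.
Qed.

(** * The four point condition for the Gromov product *)

Definition gromov p a b : R := (mdist p a + mdist p b - mdist a b) / 2.

Lemma gromovC p a b : gromov p a b = gromov p b a.
Proof. by rewrite /gromov (metric_sym a) (addrC (mdist p a)). Qed.

Lemma gromov_le_l p a b : gromov p a b <= mdist p a.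
Proof. by have := metric_triangle p a b; rewrite /gromov; lra. Qed.

Lemma gromov_le_r p a b : gromov p a b <= mdist p b.
Proof. by rewrite gromovC gromov_le_l. Qed.

(** Up to the smaller of the two products on the left, called [s], the geodesics from [p] to [a],
    [c] and [b] coincide. Going from [a] to [b] through [ga s] therefore costs
    [mdist p a + mdist p b - 2 * s], which bounds [mdist a b]. *)
Lemma real_tree_gromov p a b c :
  Num.min (gromov p a c) (gromov p c b) <= gromov p a b.
Proof.
have [_ [ga gga _]] := real_tree_geodesic p a.
have [_ [gb ggb _]] := real_tree_geodesic p b.
have [_ [gc ggc _]] := real_tree_geodesic p c.
have [u [u0 ua uc dac acE]] := real_tree_tripod gga ggc.
have [v [v0 vc vb dcb cbE]] := real_tree_tripod ggc ggb.
have -> : gromov p a c = u by rewrite /gromov dac; field.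
have -> : gromov p c b = v by rewrite /gromov dcb; field.
have [_ _ ga1] := gga; have [_ _ gb1] := ggb.
set s := Num.min u v.
have su : 0 <= s <= u by rewrite /s; case: (leP u v); lra.
have sv : 0 <= s <= v by rewrite /s; case: (leP u v); lra.
have gs : ga s = gb s by rewrite acE// cbE.
have := metric_triangle a (ga s) b.
rewrite [in X in _ <= _ + X]gs [mdist a (ga s)]metric_sym.
rewrite (geodesic_map_dist_end gga); last lra.
rewrite (geodesic_map_dist_end ggb); last lra.
by rewrite /gromov; lra.
Qed.

End Geodesics.

(** * Realizing an ultrametric by real numbers, up to constants *)

Section Separation.
Context {R : realType}.

(** The quotient [expR (n * (y - x))] grows at least linearly in [n], by [1 + z <= expR z], and so
    eventually exceeds [M / c]. *)
Lemma expR_near_le (c M x y : R) : 0 < c -> x < y ->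
  \forall n \near \oo, M * expR (- n%:R * y) <= c * expR (- n%:R * x).
Proof.
move=> c0 xy; have yx : 0 < y - x by lra.
near=> n; have nM : M / c / (y - x) <= n%:R by near: n; exact: nbhs_infty_ger.
have -> : - n%:R * x = - n%:R * y + n%:R * (y - x) by ring.
rewrite expRD [c * _]mulrCA [M * _]mulrC ler_pM2l ?expR_gt0//.
rewrite -ler_pdivrMl// mulrC; move: nM; rewrite ler_pdivrMr// => nM.
by have := expR_ge1Dx (n%:R * (y - x)); lra.
Unshelve. all: by end_near. Qed.

Lemma seq_argmax (I : eqType) (f : I -> R) (s : seq I) : s != [::] ->
  exists2 j, j \in s & forall i, i \in s -> f i <= f j.
Proof.
elim: s => [//|k s IH] _; have [->|/IH[j js jmax]] := eqVneq s [::].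
  by exists k; [rewrite mem_seq1|move=> i; rewrite mem_seq1 => /eqP ->].
have [kj|jk] := leP (f k) (f j).
  exists j; first by rewrite inE js orbT.
  by move=> i; rewrite inE => /predU1P[->|/jmax].
exists k; first by rewrite mem_head.
by move=> i; rewrite inE => /predU1P[->//|/jmax]; lra.
Qed.

(* The new point [k] is placed at distance [M * expR (- n * q k j)] from the
   point [j] maximizing [q k j]. Taking [M > C] keeps it away from the points
   [i] with [q k i = q k j], whose distance to [j] is at most
   [C * expR (- n * q k j)]; for the other [i] the shift is eventually
   negligible with respect to the distance between [i] and [j]. *)
Lemma ultrametric_separation (I : eqType) (q : I -> I -> R) (s : seq I) :
  (forall i j, q i j = q j i) ->
  (forall i j k, Num.min (q i k) (q k j) <= q i j) ->
  exists (th : I -> nat -> R) (c C : R), [/\ 0 < c, 0 < C &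
    {in s &, forall i j, i != j -> \forall n \near \oo,
      c * expR (- n%:R * q i j) <= `|th i n - th j n| <=
      C * expR (- n%:R * q i j)}].
Proof.
move=> qC qU; elim: s => [|k s [th [c [C [c0 C0 thP]]]]].
  by exists (fun _ _ => 0), 1, 1; split.
have [ks|ks] := boolP (k \in s).
  exists th, c, C; split=> // i j; rewrite !inE => is_ js.
  by apply: thP; [case/predU1P: is_ => [->|]|case/predU1P: js => [->|]].
have [->|s0] := eqVneq s [::].
  exists th, c, C; split=> // i j; rewrite !mem_seq1 => /eqP -> /eqP ->.
  by rewrite eqxx.
have [j js jmax] := seq_argmax (q k) s0.
pose M := C + 1.
pose th' i n := if i == k then th j n + M * expR (- n%:R * q k j) else th i n.
have ths i n : i \in s -> th' i n = th i n.
  by rewrite /th' => is_; case: eqVneq => // ik; rewrite -ik is_ in ks.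
have thk n : th' k n = th j n + M * expR (- n%:R * q k j).
  by rewrite /th' eqxx.
(* The [1] is [M - C], the margin left in case of a tie; [c / 2] is what remains of [c] when the
   shift of [k] takes away at most half of the lower bound. *)
have c'P : 0 < Num.min 1 (c / 2) by rewrite lt_min ltr01 divr_gt0.
have kP i : i \in s -> \forall n \near \oo,
    Num.min 1 (c / 2) * expR (- n%:R * q k i) <= `|th' k n - th' i n| <=
    (C + M) * expR (- n%:R * q k i).
  move=> is_; have [->|ij] := eqVneq i j.
    apply: nearW => n; rewrite thk ths// addrC addKr.
    rewrite ger0_norm ?mulr_ge0 ?expR_ge0//; last by rewrite /M; lra.
    by rewrite !ler_pM2r ?expR_gt0// /M ge_min; lra.
  have := jmax i is_; rewrite le_eqVlt => /orP[/eqP qe|qlt].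
    have qij : q k j <= q i j.
      by have := qU i j k; rewrite (qC i k) qe minxx.
    have /filterS : \forall n \near \oo, c * expR (- n%:R * q i j) <=
      `|th i n - th j n| <= C * expR (- n%:R * q i j) by exact: thP.
    apply=> n /andP[_ thn]; rewrite thk ths// qe.
    have e0 := expR_gt0 (- n%:R * q k j).
    have : C * expR (- n%:R * q i j) <= C * expR (- n%:R * q k j).
      by rewrite ler_pM2l// ler_expR !mulNr lerN2 ler_wpM2l.
    move: e0; move: (expR (_ * q k j)) => e e0 Ce.
    have {}thn := le_trans thn Ce.
    have m1 : Num.min 1 (c / 2) * e <= e.
      by rewrite ger_pMl// ge_min lexx.
    rewrite /M in thk *; move: thn; rewrite ler_norml => /andP[h1 h2].
    apply/andP; split.
      by apply: (le_trans m1); apply: le_trans (ler_norm _); lra.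
    by rewrite ler_norml; nra.
  (* Ultrametric triangles are isosceles: as [q k i < q k j], the two smaller of the three values
     agree. *)
  have qij : q i j = q k i.
    apply/eqP; rewrite eq_le; apply/andP; split; last first.
      have := qU i j k; rewrite (qC i k) ge_min => /orP[]; lra.
    have := qU i k j; rewrite (qC j k) (qC i k) ge_min => /orP[]; lra.
  have c20 : 0 < c / 2 by lra.
  have thij : \forall n \near \oo, c * expR (- n%:R * q i j) <=
      `|th i n - th j n| <= C * expR (- n%:R * q i j) by exact: thP.
  near=> n; rewrite thk ths//.
  have : c * expR (- n%:R * q i j) <=
      `|th i n - th j n| <= C * expR (- n%:R * q i j) by near: n.
  have : M * expR (- n%:R * q k j) <= c / 2 * expR (- n%:R * q k i).
    by near: n; exact: expR_near_le.
  have : expR (- n%:R * q k j) <= expR (- n%:R * q k i).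
    by rewrite ler_expR !mulNr lerN2 ler_wpM2l// ltW.
  rewrite qij; have := expR_gt0 (- n%:R * q k j).
  have M0 : 0 < M by rewrite /M; lra.
  move: (expR (_ * q k i)) (expR (_ * q k j)) => e e' e'0 e'e Me /andP[h1 h2].
  have Me' : 0 <= M * e' by rewrite mulr_ge0// ltW.
  have MM : M * e' <= M * e by rewrite ler_pM2l.
  have -> : th j n + M * e' - th i n = M * e' - (th i n - th j n) by ring.
  apply/andP; split.
    rewrite distrC; apply: le_trans (lerB_dist _ _).
    rewrite (ger0_norm Me').
    have : Num.min 1 (c / 2) * e <= c / 2 * e.
      by rewrite ler_pM2r ?ge_min ?lexx ?orbT//; lra.
    by lra.
  apply: (le_trans (ler_normB _ _)); rewrite (ger0_norm Me'); lra.
exists th', (Num.min 1 (c / 2)), (C + M); split=> //; first by rewrite /M; lra.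
move=> a b; rewrite !inE.
move=> /predU1P[->|as_] /predU1P[->|bs] ab; first by rewrite eqxx in ab.
- exact: kP.
- by rewrite qC; apply: filterS (kP _ as_) => n; rewrite distrC.
- apply: filterS (thP _ _ as_ bs ab) => n; rewrite !ths// => /andP[h1 h2].
  apply/andP; split; [apply: le_trans h1|apply: (le_trans h2)];
    rewrite ler_pM2r ?expR_gt0// ?ge_min; first by apply/orP; right; lra.
  by rewrite /M; lra.
Unshelve. all: by end_near. Qed.

End Separation.

(** * The hyperbolic plane in upper half plane coordinates *)

Section HalfPlane.
Context {R : realType}.
Local Open Scope complex_scope.

(** This is [(z - i) / (z + i)] at [z = x + i y], split into real and imaginary parts. *)
Definition cayley (x y : R) : R[i] :=
  ((x ^+ 2 + y ^+ 2 - 1) / (x ^+ 2 + (y + 1) ^+ 2)) +i*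
  (- (2 * x) / (x ^+ 2 + (y + 1) ^+ 2)).

Lemma cayley_denom_gt0 (x y : R) : 0 < y -> 0 < x ^+ 2 + (y + 1) ^+ 2.
Proof. by move=> y0; nra. Qed.

Lemma one_sub_sqr_normc_cayley x y : 0 < y ->
  1 - normc (cayley x y) ^+ 2 = 4 * y / (x ^+ 2 + (y + 1) ^+ 2).
Proof.
move=> y0; have /lt0r_neq0 D0 := cayley_denom_gt0 x y0.
by rewrite sqr_normcE; field.
Qed.

Lemma normc_cayley_lt1 x y : 0 < y -> normc (cayley x y) < 1.
Proof.
move=> y0; have := one_sub_sqr_normc_cayley x y0.
have : 0 < 4 * y / (x ^+ 2 + (y + 1) ^+ 2).
  by rewrite divr_gt0 ?cayley_denom_gt0//; lra.
have := normc_ge0 (cayley x y); move: (normc _) => N N0 ? ?; nra.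
Qed.

(** Here [r] is the squared hyperbolic cosine of half the distance. The two moduli [A] and [B] in
    [hdist] satisfy [A^2 = r p] and [B^2 = (r - 1) p], and the distance is [ln ((A + B)^2 / p)];
    from [0 <= B <= A], the square [(A + B)^2] lies between [A^2] and [4 A^2]. *)
Lemma hdist_cayley x1 y1 x2 y2
  (r := ((x1 - x2) ^+ 2 + (y1 + y2) ^+ 2) / (4 * y1 * y2)) :
  0 < y1 -> 0 < y2 ->
  ln r <= hdist (cayley x1 y1) (cayley x2 y2) <= ln (4 * r).
Proof.
move=> y10 y20.
rewrite hdistE ?normc_cayley_lt1// !one_sub_sqr_normc_cayley//.
have D1 := cayley_denom_gt0 x1 y10; have D2 := cayley_denom_gt0 x2 y20.
set d1 := x1 ^+ 2 + _ in D1 *; set d2 := x2 ^+ 2 + _ in D2 *.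
set p := 4 * y1 / d1 * (4 * y2 / d2).
have p0 : 0 < p by rewrite mulr_gt0// divr_gt0// mulr_gt0.
have r0 : 0 < r.
  rewrite divr_gt0 ?mulr_gt0// ltr_wpDl ?sqr_ge0// exprn_gt0//; lra.
have AE : normc (1 - cayley x1 y1 * (cayley x2 y2)^*) ^+ 2 = r * p.
  rewrite /cayley sqr_normcE /r /p /d1 /d2.
  by field; rewrite !lt0r_neq0.
have BE : normc (cayley x1 y1 - cayley x2 y2) ^+ 2 = r * p - p.
  have := hdist_identity (cayley x1 y1) (cayley x2 y2).
  by rewrite !one_sub_sqr_normc_cayley// -/d1 -/d2 -/p AE; lra.
have := normc_ge0 (1 - cayley x1 y1 * (cayley x2 y2)^*).
have := normc_ge0 (cayley x1 y1 - cayley x2 y2).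
move: AE BE; move: (normc (1 - _)) (normc (cayley _ _ - _)) => A B AE BE B0 A0.
have BA : B <= A by rewrite -ler_sqr ?nnegrE// AE BE; lra.
have lo : r <= (A + B) ^+ 2 / p by rewrite ler_pdivlMr// -AE; nra.
have hi : (A + B) ^+ 2 / p <= 4 * r by rewrite ler_pdivrMr// -mulrA -AE; nra.
by rewrite !ler_ln ?posrE ?lo ?hi//; lra.
Qed.

Definition half_plane_point (x y : R) (y0 : 0 < y) : hyperbolic_plane R :=
  exist _ (cayley x y) (normc_cayley_lt1 x y0).

Lemma mdist_half_plane_point x1 y1 x2 y2 (y10 : 0 < y1) (y20 : 0 < y2)
  (r := ((x1 - x2) ^+ 2 + (y1 + y2) ^+ 2) / (4 * y1 * y2)) :
  ln r <= mdist (half_plane_point x1 y10) (half_plane_point x2 y20)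
       <= ln (4 * r).
Proof. exact: hdist_cayley. Qed.

Lemma diameter_hyperbolic_plane : diameter (hyperbolic_plane R) = +oo%E.
Proof.
rewrite /diameter.
rewrite -(image_comp (fun p => mdist p.1 p.2) EFin setT).
apply: hasNub_ereal_sup; last first.
  pose o := half_plane_point 0 ltr01.
  by exists (mdist o o), (o, o).
(* For the points [i] and [i y] the ratio is [(1 + y)^2 / (4 y)], which exceeds [1 / (4 y)]; this
   [y] makes the latter equal to [expR (B + 1)]. *)
move=> [B ubB]; pose y := expR (- (B + 1)) / 4.
have y0 : 0 < y by rewrite divr_gt0 ?expR_gt0.
have ye : expR (B + 1) * (4 * y) = 1.
  by rewrite /y [4 * _]mulrC divfK// -expRD subrr expR0.
move: (y) (y0) ye => {}y {}y0 ye.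
pose o := half_plane_point 0 ltr01; pose z := half_plane_point 0 y0.
have : mdist o z <= B by apply: ubB; exists (o, z).
have /andP[+ _] := mdist_half_plane_point 0 0 ltr01 y0.
rewrite -/o -/z; set r := _ / _ => rz oz.
have : expR (B + 1) <= r.
  have y40 : 0 < 4 * y by rewrite mulr_gt0.
  by rewrite /r subrr expr0n add0r mulr1 ler_pdivlMr// ye; nra.
move=> er; have r0 : 0 < r by apply: lt_le_trans er; exact: expR_gt0.
have : B + 1 <= ln r by rewrite -ler_expR lnK ?posrE.
by lra.
Qed.

End HalfPlane.

(** * Embedding finite sets at infinity *)

Section Embedding.
Context {R : realType}.

Lemma cvg_harmonicM (f : nat -> R) (d K : R) :
  (\forall n \near \oo, `|f n - n%:R * d| <= K) ->
  (fun n => harmonic n * f n) @ \oo --> d.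
Proof.
move=> fK; pose g (e : R) n := d + e * (K + `|d|) * harmonic n.
have gd e : g e @ \oo --> d.
  rewrite -[X in _ --> X]addr0 -[X in _ --> _ + X](mulr0 (e * (K + `|d|))).
  by apply: cvgD; [exact: cvg_cst|apply: cvgMr; exact: cvg_harmonic].
apply: (squeeze_cvgr _ (gd (-1)) (gd 1)).
near=> n.
(* As [harmonic n] is [1 / (n + 1)], the comparison must be with [(n + 1) d] rather than [n d]; the
   extra [d] goes into the constant. *)
have : `|f n - n.+1%:R * d| <= K + `|d|.
  have -> : f n - n.+1%:R * d = (f n - n%:R * d) - d.
    by rewrite -natr1; ring.
  by apply: (le_trans (ler_normB _ _)); rewrite lerD2r; near: n.
rewrite ler_norml /g /= => /andP[h1 h2].
have n0 : 0 < n.+1%:R :> R by rewrite ltr0n.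
have -> : n.+1%:R^-1 * f n = d + (f n - n.+1%:R * d) * n.+1%:R^-1.
  by field; rewrite gt_eqF.
by rewrite !lerD2l !ler_pM2r ?invr_gt0//; apply/andP; split; lra.
Unshelve. all: by end_near. Qed.

(** Neither height exceeds [e = expR (- t * gromov p a b)], so the numerator of [r] is [e^2] up to
    constant factors. Since [e^2] is [expR (t * mdist a b)] times the product of the heights, [r] is
    comparable to [expR (t * mdist a b)], and taking logarithms leaves an error independent of
    [t]. *)
Lemma mdist_half_plane_point_gromov (T : metricType R) (p a b : T)
  (c C : R) (t x1 x2 : R) : 0 < c -> 0 < C -> 0 <= t ->
  c * expR (- t * gromov p a b) <= `|x1 - x2|
    <= C * expR (- t * gromov p a b) ->
  `|mdist (half_plane_point x1 (expR_gt0 (- t * mdist p a)))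
          (half_plane_point x2 (expR_gt0 (- t * mdist p b))) -
    t * mdist a b| <= `|ln (c ^+ 2 / 4)| + `|ln (C ^+ 2 + 4)|.
Proof.
move=> c0 C0 t0 /andP[lo hi].
have := mdist_half_plane_point x1 x2 (expR_gt0 (- t * mdist p a))
  (expR_gt0 (- t * mdist p b)).
move: (mdist (half_plane_point _ _) _) => D.
have ea : expR (- t * mdist p a) <= expR (- t * gromov p a b).
  by rewrite ler_expR !mulNr lerN2 ler_wpM2l// gromov_le_l.
have eb : expR (- t * mdist p b) <= expR (- t * gromov p a b).
  by rewrite ler_expR !mulNr lerN2 ler_wpM2l// gromov_le_r.
have eE : expR (- t * gromov p a b) ^+ 2 =
    expR (t * mdist a b) * (expR (- t * mdist p a) * expR (- t * mdist p b)).
  by rewrite expr2 -!expRD; congr expR; rewrite /gromov; field.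
have := expR_gt0 (- t * mdist p a); have := expR_gt0 (- t * mdist p b).
have := expR_gt0 (- t * gromov p a b); have := expR_gt0 (t * mdist a b).
move: lo hi ea eb eE (esym (expRK (t * mdist a b))).
move: (expR (- t * gromov p a b)) (expR (t * mdist a b)) => e E.
move: (expR (- t * mdist p a)) (expR (- t * mdist p b)).
move=> y1 y2 lo hi y1e y2e eE -> E0 e0 y20 y10.
set r := _ / (_ * _) => /andP[rD Dr].
have y120 : 0 < 4 * y1 * y2 by rewrite !mulr_gt0.
have xx : `|x1 - x2| ^+ 2 = (x1 - x2) ^+ 2 by rewrite real_normK ?num_real.
have ce0 : 0 < c * e by rewrite mulr_gt0.
have lo2 : c ^+ 2 / 4 * E <= r.
  rewrite ler_pdivlMr// -xx.
  have : (c * e) ^+ 2 <= `|x1 - x2| ^+ 2.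
    by rewrite ler_sqr ?nnegrE ?(ltW ce0).
  by rewrite exprMn eE; nra.
have hi2 : 4 * r <= (C ^+ 2 + 4) * E.
  rewrite /r mulrA ler_pdivrMr// -xx.
  have : `|x1 - x2| ^+ 2 <= (C * e) ^+ 2.
    by rewrite ler_sqr ?nnegrE// mulr_ge0 ?ltW.
  have : (y1 + y2) ^+ 2 <= 4 * e ^+ 2 by nra.
  by rewrite exprMn eE; nra.
have c20 : 0 < c ^+ 2 / 4 by rewrite divr_gt0 ?exprn_gt0.
have C20 : 0 < C ^+ 2 + 4 by rewrite ltr_wpDl ?sqr_ge0.
have r0 : 0 < r by apply: lt_le_trans lo2; rewrite mulr_gt0.
have {}lo2 : ln (c ^+ 2 / 4) + ln E <= ln r.
  by rewrite -lnM ?ler_ln ?posrE// mulr_gt0.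
have {}hi2 : ln (4 * r) <= ln (C ^+ 2 + 4) + ln E.
  by rewrite -lnM ?ler_ln ?posrE// mulr_gt0.
have := ler_norm (ln (C ^+ 2 + 4)); have := ler_norm (- ln (c ^+ 2 / 4)).
have := normr_ge0 (ln (C ^+ 2 + 4)); have := normr_ge0 (ln (c ^+ 2 / 4)).
by rewrite normrN ler_norml => *; apply/andP; split; lra.
Qed.

Lemma gromov_embeds_at_infinity (T : metricType R) (p : T) (F : set T) :
  (forall a b c : T, Num.min (gromov p a c) (gromov p c b) <= gromov p a b) ->
  finite_set F ->
  isometrically_embeds_at_infinity (subspace_metric F) (hyperbolic_plane R).
Proof.
move=> hyp /finite_seqP[s FE]; split; first exact: diameter_hyperbolic_plane.
have [th [c [C [c0 C0 thP]]]] := ultrametric_separation s (@gromovC _ _ p) hyp.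
exists (@harmonic R); split; [exact: harmonic_gt0|exact: cvg_harmonic|].
pose v (t : subspace_metric F) : T := \val (t : set_type F).
exists (fun t n => half_plane_point (th (v t) n)
  (expR_gt0 (- n%:R * mdist p (v t)))) => t1 t2.
have vs t : v t \in s by have := set_valP t; rewrite [X in X _ -> _]FE.
(* The separation [thP] concerns distinct points only; for equal ones both distances vanish. *)
have [<-|t12] := eqVneq t1 t2.
  rewrite mdistxx; under eq_fun do rewrite mdistxx mulr0.
  exact: cvg_cst.
rewrite [mdist t1 t2](_ : _ = mdist (v t1) (v t2))//.
apply: (@cvg_harmonicM _ _ (`|ln (c ^+ 2 / 4)| + `|ln (C ^+ 2 + 4)|)).
have v12 : v t1 != v t2 by apply: contra_neq t12 => /val_inj.
apply: filterS (thP _ _ (vs t1) (vs t2) v12) => n thn.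
exact: mdist_half_plane_point_gromov.
Qed.

End Embedding.

Theorem corollary3p10 (R : realType) (T : metricType R)
  (hT : real_tree_countably_many_vertices T) :
  asymptotic_subcone T (hyperbolic_plane R).
Proof.
have [treeT _] := hT; split; first exact: real_tree_geodesic.
move=> F finF; have [[p _]|F0] := pselect (exists p, F p).
  apply: (@gromov_embeds_at_infinity _ _ p) => // a b c.
  exact: real_tree_gromov.
(* For empty [F] there is no base point to take from it, and [T] itself may be empty. The sequences
   are then indexed by an empty type, so any constant choice serves. *)
split; first exact: diameter_hyperbolic_plane.
exists (@harmonic R); split; [exact: harmonic_gt0|exact: cvg_harmonic|].
exists (fun _ _ => half_plane_point 0 ltr01) => t.
by case: F0; exists (\val (t : set_type F)); exact: set_valP.
Qed.
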